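(* (Kleene Theorem.) Let $L\subseteq\mathrm{GS}$. The following are equivalent: (1) $L=[\![e]\!]$ for some GKAT expression $e\in\mathrm{Exp}$. (2) $L=\ell^{\mathcal{X}}(\iota)$ for some well-nested, finite-state $G$-automaton $\mathcal{X}$ with initial state $\iota$.
   Context: Syntax. Fix disjoint nonempty sets $\Sigma$ (actions) and $T=\{t_1,\dots,t_n\}$ (primitive tests), $T$ finite. Boolean expressions $b,c\in\mathrm{BExp}$ are generated by $0 \mid 1 \mid t\in T \mid b\cdot c \mid b+c \mid \overline{b}$. GKAT expressions $e,f\in\mathrm{Exp}$ are generated by $p\in\Sigma \mid b\in\mathrm{BExp} \mid e\cdot f \mid e+_b f \mid e^{(b)}$. $\equiv_{BA}$ denotes Boolean equivalence, $b\le c$ iff $b+c\equiv_{BA}c$. $\mathrm{At}$ is the finite set of atoms (minimal nonzero elements) of the free Boolean algebra $\mathrm{BExp}/{\equiv_{BA}}$ on $T$. Language model. Guarded strings: $\mathrm{GS}=\mathrm{At}\cdot(\Sigma\cdot\mathrm{At})^*$. Fusion product: $x\alpha\diamond\beta y = x\alpha y$ if $\alpha=\beta$, undefined otherwise; for $L,K\subseteq\mathrm{GS}$, $L\diamond K=\{x\diamond y : x\in L,y\in K, x\diamond y\text{ defined}\}$; $L^0=\mathrm{At}$, $L^{n+1}=L^n\diamond L$. For $B\subseteq\mathrm{At}$, $\overline{B}=\mathrm{At}\setminus B$, $L+_BK=(B\diamond L)\cup(\overline{B}\diamond K)$, $L^{(B)}=\bigcup_{n\ge0}(B\diamond L)^n\diamond\overline{B}$.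 Then $[\![-]\!]:\mathrm{Exp}\to 2^{\mathrm{GS}}$ is: $[\![p]\!]=\{\alpha p\beta:\alpha,\beta\in\mathrm{At}\}$, $[\![b]\!]=\{\alpha\in\mathrm{At}:\alpha\le b\}$, $[\![e\cdot f]\!]=[\![e]\!]\diamond[\![f]\!]$, $[\![e+_bf]\!]=[\![e]\!]+_{[\![b]\!]}[\![f]\!]$, $[\![e^{(b)}]\!]=[\![e]\!]^{([\![b]\!])}$. Automata. Let $GX=(2+\Sigma\times X)^{\mathrm{At}}$ with $2=\{0,1\}$. A $G$-coalgebra is a pair $\mathcal{X}=\langle X,\delta^{\mathcal{X}}\rangle$ with $\delta^{\mathcal{X}}:X\to GX$; a $G$-automaton is a $G$-coalgebra with a designated start state (and is well-nested if the underlying coalgebra is). The language $\ell^{\mathcal{X}}(s)\subseteq\mathrm{GS}$ of a state $s$ is defined inductively: $\alpha\in\ell^{\mathcal{X}}(s)$ iff $\delta^{\mathcal{X}}(s)(\alpha)=1$; $\alpha px\in\ell^{\mathcal{X}}(s)$ iff $\delta^{\mathcal{X}}(s)(\alpha)=(p,t)$ for some $t$ with $x\in\ell^{\mathcal{X}}(t)$. The coproduct $\mathcal{X}+\mathcal{Y}$ has the disjoint union $X+Y$ as states, with $\delta^{\mathcal{X}}$ on $X$ and $\delta^{\mathcal{Y}}$ on $Y$. For $Y\subseteq X$ and $h\in GX$, the uniform continuation $\mathcal{X}[Y,h]=\langle X,\delta[Y,h]\rangle$ is given by $\delta[Y,h](x)(\alpha)=h(\alpha)$ if $x\in Y$ and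 $\delta^{\mathcal{X}}(x)(\alpha)=1$, and $\delta^{\mathcal{X}}(x)(\alpha)$ otherwise. Well-nested coalgebras are defined inductively: (i) if $\mathcal{X}$ has no transitions, i.e. $\delta^{\mathcal{X}}(x)(\alpha)\in2$ for all $x,\alpha$, then $\mathcal{X}$ is well-nested; (ii) if $\mathcal{X}$ and $\mathcal{Y}$ are well-nested and $h\in G(X+Y)$, then $(\mathcal{X}+\mathcal{Y})[X,h]$ is well-nested. *)

(* Defs.v *)
From HB Require Import structures.
From mathcomp Require Import all_boot.
From mathcomp Require Import boolp classical_sets cardinality.

Set Implicit Arguments.
Unset Strict Implicit.
Unset Printing Implicit Defensive.

Local Open Scope classical_set_scope.
Local Open Scope quotient_scope.

Inductive bexp (T : Type) : Type :=
  | BZero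
  | BOne
  | BTest of T
  | BAnd of bexp T & bexp T
  | BOr of bexp T & bexp T
  | BNot of bexp T.

Arguments BZero {T}.
Arguments BOne {T}.

Inductive gexp (Sigma T : Type) : Type :=
  | EAct of Sigma
  | ETest of bexp T
  | ESeq of gexp Sigma T & gexp Sigma T
  | EIf of bexp T & gexp Sigma T & gexp Sigma T
  | EWhile of bexp T & gexp Sigma T.

(* The least congruence on Boolean expressions containing the axioms of
   Boolean algebra. *)
Inductive ba_eq (T : Type) : bexp T -> bexp T -> Prop :=
  | ba_refl b : ba_eq b b
  | ba_sym b c : ba_eq b c -> ba_eq c b
  | ba_trans c b d : ba_eq b c -> ba_eq c d -> ba_eq b d
  | ba_congA b b' c c' :
      ba_eq b b' -> ba_eq c c' -> ba_eq (BAnd b c) (BAnd b' c')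
  | ba_congO b b' c c' :
      ba_eq b b' -> ba_eq c c' -> ba_eq (BOr b c) (BOr b' c')
  | ba_congN b b' : ba_eq b b' -> ba_eq (BNot b) (BNot b')
  | ba_andA b c d : ba_eq (BAnd b (BAnd c d)) (BAnd (BAnd b c) d)
  | ba_orA b c d : ba_eq (BOr b (BOr c d)) (BOr (BOr b c) d)
  | ba_andC b c : ba_eq (BAnd b c) (BAnd c b)
  | ba_orC b c : ba_eq (BOr b c) (BOr c b)
  | ba_andK b c : ba_eq (BAnd b (BOr b c)) b
  | ba_orK b c : ba_eq (BOr b (BAnd b c)) b
  | ba_andDr b c d : ba_eq (BAnd b (BOr c d)) (BOr (BAnd b c) (BAnd b d))
  | ba_orDr b c d : ba_eq (BOr b (BAnd c d)) (BAnd (BOr b c) (BOr b d))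
  | ba_and1 b : ba_eq (BAnd b BOne) b
  | ba_or0 b : ba_eq (BOr b BZero) b
  | ba_andN b : ba_eq (BAnd b (BNot b)) BZero
  | ba_orN b : ba_eq (BOr b (BNot b)) BOne.

Definition ba_le (T : Type) (b c : bexp T) : Prop := ba_eq (BOr b c) c.

HB.instance Definition _ (T : Type) := gen_eqMixin (bexp T).
HB.instance Definition _ (T : Type) := gen_choiceMixin (bexp T).

Definition ba_eqb (T : Type) (b c : bexp T) : bool := `[< ba_eq b c >].

Lemma ba_eqb_equiv (T : Type) : equiv_class_of (@ba_eqb T).
Proof.
split=> [b|b c|c b d].
- exact/asboolP/ba_refl.
- by apply/asboolP/asboolP; apply: ba_sym.
- by move=> /asboolP bc /asboolP cd; apply/asboolP/(ba_trans bc cd).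
Qed.

Canonical ba_equiv (T : Type) := EquivRelPack (ba_eqb_equiv T).

(* The free Boolean algebra on T. *)
Definition free_ba (T : Type) := {eq_quot @ba_equiv T}.

Lemma free_baP (T : Type) (b c : bexp T) :
  \pi_(free_ba T) b = \pi_(free_ba T) c <-> ba_eq b c.
Proof.
by split=> [/eqmodP/asboolP//|bc]; apply/eqmodP/asboolP.
Qed.

Definition fb_zero (T : Type) : free_ba T := \pi_(free_ba T) BZero.

Definition fb_le (T : Type) (q r : free_ba T) : Prop := ba_le (repr q) (repr r).

Lemma fb_leE (T : Type) (b c : bexp T) :
  fb_le (\pi_(free_ba T) b) (\pi_(free_ba T) c) <-> ba_le b c.
Proof.
have rK d : ba_eq (repr (\pi_(free_ba T) d)) d by apply/free_baP; rewrite reprK.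
rewrite /fb_le /ba_le; split=> h.
- apply: ba_trans (ba_trans h (rK c)).
  by apply: ba_congO; apply: ba_sym; apply: rK.
- apply: ba_trans (ba_trans h (ba_sym (rK c))).
  by apply: ba_congO; apply: rK.
Qed.

Definition is_atom (T : Type) (q : free_ba T) : Prop :=
  q <> fb_zero T /\
  forall r : free_ba T, r <> fb_zero T -> fb_le r q -> r = q.

Definition At (T : Type) := {q : free_ba T | `[< is_atom q >]}.

Definition at_le (T : Type) (a : At T) (b : bexp T) : Prop :=
  fb_le (val a) (\pi_(free_ba T) b).

(* The guarded string a0 p1 a1 ... pk ak is (a0, [:: (p1, a1); ...; (pk, ak)]). *)
Definition gs (Sigma T : Type) : Type := (At T * seq (Sigma * At T))%type.

Section Languages.
Variables Sigma T : Type.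
Implicit Types (x y : gs Sigma T) (B : set (At T)) (L K : set (gs Sigma T)).

Definition gs_first x : At T := x.1.
Definition gs_last x : At T := last x.1 (unzip2 x.2).

Definition fusion x y : option (gs Sigma T) :=
  if gs_last x == gs_first y then Some (x.1, x.2 ++ y.2) else None.

Definition lang_fusion L K : set (gs Sigma T) :=
  [set z | exists x y, [/\ L x, K y & fusion x y = Some z]].

Definition lang_atoms B : set (gs Sigma T) := [set (a, [::]) | a in B].

Fixpoint lang_pow L (n : nat) : set (gs Sigma T) :=
  if n is m.+1 then lang_fusion (lang_pow L m) L else lang_atoms setT.

Definition lang_if B L K : set (gs Sigma T) :=
  lang_fusion (lang_atoms B) L `|` lang_fusion (lang_atoms (~` B)) K.

Definition lang_while B L : set (gs Sigma T) :=
  \bigcup_n lang_fusion (lang_pow (lang_fusion (lang_atoms B) L) n)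
                        (lang_atoms (~` B)).

Definition lang_act (p : Sigma) : set (gs Sigma T) :=
  [set x | exists a b, x = (a, [:: (p, b)])].

Definition bsem (b : bexp T) : set (At T) := [set a | at_le a b].

Fixpoint sem (e : gexp Sigma T) : set (gs Sigma T) :=
  match e with
  | EAct p => lang_act p
  | ETest b => lang_atoms (bsem b)
  | ESeq f g => lang_fusion (sem f) (sem g)
  | EIf b f g => lang_if (bsem b) (sem f) (sem g)
  | EWhile b f => lang_while (bsem b) (sem f)
  end.

End Languages.

(* inl true, inl false and inr (p, x) are 1 (accept), 0 (reject) and the
   transition (p, x). *)
Definition G (Sigma T X : Type) : Type := At T -> bool + Sigma * X.

Record coalg (Sigma T : Type) : Type := Coalg {
  state :> Type;
  delta : state -> G Sigma T state
}.

Section Automata.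
Variables Sigma T : Type.

Fixpoint accepts (X : coalg Sigma T) (s : X) (a : At T)
    (w : seq (Sigma * At T)) : Prop :=
  match w with
  | [::] => delta s a = inl true
  | (p, b) :: w' => exists t : X, delta s a = inr (p, t) /\ accepts t b w'
  end.

Definition lang (X : coalg Sigma T) (s : X) : set (gs Sigma T) :=
  [set x | accepts s x.1 x.2].

Definition coprod_delta (X Y : coalg Sigma T) (z : X + Y) :
    G Sigma T (X + Y) :=
  fun a => match z with
  | inl x => match delta x a with
             | inl o => inl o
             | inr (p, x') => inr (p, inl x')
             end
  | inr y => match delta y a with
             | inl o => inl o
             | inr (p, y') => inr (p, inr y')
             end
  end.

Definition coprod (X Y : coalg Sigma T) : coalg Sigma T :=
  Coalg (@coprod_delta X Y).

Definition unif_cont (X : coalg Sigma T) (Y : set X) (h : G Sigma T X) :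
    coalg Sigma T :=
  Coalg (fun (x : X) a =>
    match delta x a with
    | inl true => if x \in Y then h a else inl true
    | o => o
    end).

(* Note that the carrier of the coproduct is literally the sum type, so this
   class is not closed under isomorphism of coalgebras. *)
Inductive well_nested : coalg Sigma T -> Prop :=
  | wn_discrete (X : coalg Sigma T) :
      (forall (x : X) a, exists o : bool, delta x a = inl o) -> well_nested X
  | wn_cont (X Y : coalg Sigma T) (h : G Sigma T (X + Y)) :
      well_nested X -> well_nested Y ->
      well_nested (@unif_cont (coprod X Y) (range inl) h).

End Automata.

(* Main.v *)
(** From expressions to automata, Thompson's construction gives a well-nested
    coalgebra together with a pseudo-state [i : G Sigma T X] whose language is
    that of the expression; sequencing and looping are uniform continuations
    along pseudo-states.

    From automata to expressions, one inducts on well-nestedness.  In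
    [(X + Y)[X, h]] the states of [Y] keep their language and a state [x] of [X]
    gets the language [lang x] followed by the language [H] of [h].  By Arden's
    rule [H] is the language of a loop whose body is the part of [h] that
    re-enters [X], followed by the part of [h] that does not.  Guarded choices
    over atoms are finite sums because [At T] is finite. *)

Require Import Defs.
From mathcomp Require Import all_boot.
From mathcomp Require Import boolp classical_sets cardinality.
From Stdlib Require Import Setoid Morphisms.

Set Implicit Arguments.
Unset Strict Implicit.
Unset Printing Implicit Defensive.

Local Open Scope classical_set_scope.

(** * Boolean reasoning modulo [ba_eq] *)

#[local] Instance ba_eq_equivalence (T : Type) : Equivalence (@ba_eq T).
Proof.
by split; [exact: ba_refl | exact: ba_sym | move=> x y z; exact: ba_trans].
Qed.

#[local] Hint Resolve ba_refl : core.

#[local] Instance BAnd_proper (T : Type) :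
  Proper (@ba_eq T ==> @ba_eq T ==> @ba_eq T) (@BAnd T).
Proof. by move=> b b' bb c c' cc; exact: ba_congA. Qed.

#[local] Instance BOr_proper (T : Type) :
  Proper (@ba_eq T ==> @ba_eq T ==> @ba_eq T) (@BOr T).
Proof. by move=> b b' bb c c' cc; exact: ba_congO. Qed.

Section BooleanAlgebra.
Variable T : Type.
Implicit Types b c q : bexp T.

Lemma ba_le_and b c : ba_le b c <-> ba_eq (BAnd b c) b.
Proof.
rewrite /ba_le; split=> h; first by rewrite -h ba_andK.
by rewrite -h ba_orC ba_andC ba_orK.
Qed.

Lemma ba_and0 b : ba_eq (BAnd b BZero) BZero.
Proof.
have /ba_le_and h : ba_le BZero b by rewrite /ba_le ba_orC ba_or0.
by rewrite ba_andC.
Qed.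

Lemma ba_andI b : ba_eq (BAnd b b) b.
Proof.
apply/ba_le_and; rewrite /ba_le.
by setoid_rewrite <- (ba_and1 b) at 2; exact: ba_orK.
Qed.

(** [is_atom] on expressions instead of quotient classes, so that proofs can rewrite with
    [ba_eq]. *)
Definition atomic q : Prop :=
  ~ ba_eq q BZero /\ forall r, ~ ba_eq r BZero -> ba_le r q -> ba_eq r q.

Section Atomic.
Variables (q : bexp T) (atq : atomic q).

(** [BAnd q b] lies below [q], so minimality leaves only [q] and zero. This dichotomy is what lets
    an atom decide each connective below. *)
Lemma atomic_and b : ba_eq (BAnd q b) q \/ ba_eq (BAnd q b) BZero.
Proof.
have [|nz] := pselect (ba_eq (BAnd q b) BZero); [by right|left].
apply: atq.2 => //; apply/ba_le_and.
by rewrite (ba_andC q b) -ba_andA ba_andI.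
Qed.

Lemma atomic_le_zero : ~ ba_le q BZero.
Proof. by move=> /ba_le_and; rewrite ba_and0 => /ba_sym; exact: atq.1. Qed.

Lemma atomic_le_one : ba_le q BOne.
Proof. by apply/ba_le_and; exact: ba_and1. Qed.

Lemma atomic_le_and b c : ba_le q (BAnd b c) <-> ba_le q b /\ ba_le q c.
Proof.
have aux d e : ba_le q (BAnd d e) -> ba_le q d.
  move=> /ba_le_and h; apply/ba_le_and; have [//|z] := atomic_and d.
  case: atq.1; rewrite -h ba_andA z ba_andC; exact: ba_and0.
split=> [h|[/ba_le_and hb /ba_le_and hc]].
  split; first exact: aux h.
  by apply: (@aux _ b); move/ba_le_and: h => h; apply/ba_le_and;
    rewrite (ba_andC c).
by apply/ba_le_and; rewrite ba_andA hb.
Qed.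

Lemma atomic_le_or b c : ba_le q (BOr b c) <-> ba_le q b \/ ba_le q c.
Proof.
split=> [/ba_le_and|].
  rewrite ba_andDr => h.
  have [hb|zb] := atomic_and b; first by left; apply/ba_le_and.
  have [hc|zc] := atomic_and c; first by right; apply/ba_le_and.
  by case: atq.1; rewrite -h zb zc ba_or0.
case=> /ba_le_and h; apply/ba_le_and; rewrite ba_andDr h; last rewrite ba_orC.
  exact: ba_orK.
exact: ba_orK.
Qed.

Lemma atomic_le_not b : ba_le q (BNot b) <-> ~ ba_le q b.
Proof.
split=> [/ba_le_and hn /ba_le_and h|nh].
  by case: atq.1; rewrite -hn -h -ba_andA ba_andN ba_and0.
have [/ba_le_and //|z] := atomic_and b.
(* Expands [q] into its meets with [b] and with [BNot b]; the first one vanishes by [z]. *)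
apply/ba_le_and; rewrite -{2}(ba_and1 q) -(ba_orN b) ba_andDr z.
by rewrite ba_orC ba_or0.
Qed.

End Atomic.
End BooleanAlgebra.

(** * Atoms as valuations of the primitive tests *)

Section Atoms.
Variable T : Type.
Implicit Types (a : At T) (b c : bexp T).

Definition at_repr a : bexp T := repr (val a).

Lemma fb_le_reprl (r : free_ba T) b :
  fb_le r (\pi_(free_ba T)%qT b) <-> ba_le (repr r) b.
Proof. by rewrite -{1}[r]reprK fb_leE. Qed.

Lemma at_leE a b : at_le a b <-> ba_le (at_repr a) b.
Proof. exact: fb_le_reprl. Qed.

Lemma at_repr_atomic a : atomic (at_repr a).
Proof.
rewrite /at_repr; case: a => q /= /asboolP[q0 qmin]; split=> [h|r r0 rq].
  by apply: q0; rewrite /fb_zero -[q]reprK; apply/free_baP.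
apply/free_baP; rewrite reprK; apply: qmin; first by move/free_baP.
by rewrite -{1}[q]reprK; apply/fb_leE.
Qed.

(** Comparable atoms coincide because the smaller one is nonzero. Hence [at_repr a'] is a test that
    singles out one atom. *)
Lemma at_le_repr a a' : at_le a (at_repr a') <-> a = a'.
Proof.
split=> [/at_leE h|->]; last first.
  by apply/at_leE/ba_le_and; exact: ba_andI.
have e := (at_repr_atomic a').2 _ (at_repr_atomic a).1 h.
by apply/val_inj; rewrite -[LHS]reprK -[RHS]reprK; apply/free_baP.
Qed.

Lemma at_le_zero a : ~ at_le a BZero.
Proof. by move/at_leE; exact/atomic_le_zero/at_repr_atomic. Qed.

Lemma at_le_one a : at_le a BOne.
Proof. by apply/at_leE; exact: atomic_le_one. Qed.

Lemma at_le_and a b c : at_le a (BAnd b c) <-> at_le a b /\ at_le a c.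
Proof. by rewrite !at_leE; exact/atomic_le_and/at_repr_atomic. Qed.

Lemma at_le_or a b c : at_le a (BOr b c) <-> at_le a b \/ at_le a c.
Proof. by rewrite !at_leE; exact/atomic_le_or/at_repr_atomic. Qed.

Lemma at_le_not a b : at_le a (BNot b) <-> ~ at_le a b.
Proof. by rewrite !at_leE; exact/atomic_le_not/at_repr_atomic. Qed.

(** By the preceding lemmas an atom behaves as a valuation, so agreement on primitive tests extends
    to all expressions, in particular to [at_repr a']. *)
Lemma at_ext a a' :
  (forall t, at_le a (BTest t) <-> at_le a' (BTest t)) -> a = a'.
Proof.
move=> eq_aa'; suff h b : at_le a b <-> at_le a' b.
  by apply/at_le_repr/h/at_le_repr.
elim: b => [|||b IHb c IHc|b IHb c IHc|b IHb].
- by split=> /at_le_zero.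
- by split=> _; exact: at_le_one.
- exact: eq_aa'.
- by rewrite !at_le_and IHb IHc.
- by rewrite !at_le_or IHb IHc.
- by rewrite !at_le_not IHb.
Qed.

End Atoms.

(** By [at_ext], sending an atom to the set of primitive tests above it embeds the atoms into the
    finite powerset of [T]. *)
Lemma finite_At (T : finType) : exists s : seq (At T), forall a, a \in s.
Proof.
pose f (a : At T) : {set T} := [set t | `[< at_le a (BTest t) >]]%SET.
have /finite_seqP[s sE] : finite_set (f @^-1` [set: {set T}]).
  apply: finite_preimage; last exact: finite_finset.
  move=> a a' _ _ /setP ff; apply: at_ext => t.
  have := ff t; rewrite !inE => e.
  by split=> /asboolP h; apply/asboolP; rewrite ?e // -e.
exists s => a; suff : [set` s] a by [].
by rewrite -sE.
Qed.

(** * Fusion, iteration and Arden's rule *)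

Section Languages.
Variables Sigma T : Type.
Implicit Types (a b : At T) (w u v : seq (Sigma * At T)).
Implicit Types (B : set (At T)) (K L M N H : set (gs Sigma T)).

Definition end_atom a u : At T := last a (unzip2 u).

Lemma end_atom_cat a u v : end_atom a (u ++ v) = end_atom (end_atom a u) v.
Proof. by rewrite /end_atom /unzip2 map_cat last_cat. Qed.

(** The atom shared by two fused strings is stored once, so a decomposition is a splitting of the
    tail, with [end_atom a u] as first atom of the second string. *)
Lemma lang_fusionP L K a w : lang_fusion L K (a, w) <->
  exists u v, [/\ w = u ++ v, L (a, u) & K (end_atom a u, v)].
Proof.
split=> [[[a1 u] [[a2 v] [Lx Ky]]]|[u [v [-> Lu Kv]]]].
  rewrite /fusion; case: eqP => // e [<- <-]; exists u, v.
  by move: e Ky; rewrite /gs_last /gs_first /= => <-.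
by exists (a, u), (end_atom a u, v); split=> //; rewrite /fusion eqxx.
Qed.

Lemma lang_fusionA L M N :
  lang_fusion L (lang_fusion M N) = lang_fusion (lang_fusion L M) N.
Proof.
apply/seteqP; split=> -[a w] /lang_fusionP.
  move=> [u [_ [-> Lu /lang_fusionP[v [x [-> Mv Nx]]]]]].
  apply/lang_fusionP; exists (u ++ v), x; rewrite catA end_atom_cat.
  by split=> //; apply/lang_fusionP; exists u, v.
move=> [_ [x [-> /lang_fusionP[u [v [-> Lu Mv]]] Nx]]].
rewrite end_atom_cat in Nx; apply/lang_fusionP.
exists u, (v ++ x); rewrite catA; split=> //.
by apply/lang_fusionP; exists v, x.
Qed.

Lemma lang_fusionS L L' K K' :
  L `<=` L' -> K `<=` K' -> lang_fusion L K `<=` lang_fusion L' K'.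
Proof.
move=> LL' KK' [a w] /lang_fusionP[u [v [-> Lu Kv]]]; apply/lang_fusionP.
by exists u, v; split=> //; [exact: LL' | exact: KK'].
Qed.

Lemma lang_atomsP B a w : lang_atoms B (a, w) <-> B a /\ w = [::].
Proof. by split=> [[b Bb [<- <-]]|[Ba ->]] //; exists a. Qed.

Lemma atoms_fusionP B L a w :
  lang_fusion (lang_atoms B) L (a, w) <-> B a /\ L (a, w).
Proof.
rewrite lang_fusionP; split=> [[u [v [-> /lang_atomsP[Ba ->] Lv]]]|[Ba Lw]] //.
by exists [::], w; split=> //; apply/lang_atomsP.
Qed.

Lemma fusion1l L : lang_fusion (lang_atoms setT) L = L.
Proof.
by apply/seteqP; split=> -[a w]; rewrite atoms_fusionP //; case.
Qed.

Lemma fusion1r L : lang_fusion L (lang_atoms setT) = L.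
Proof.
apply/seteqP; split=> -[a w]; rewrite lang_fusionP.
  by case=> u [v [-> Lu /lang_atomsP[_ ->]]]; rewrite cats0.
by move=> Lw; exists w, [::]; rewrite cats0; split=> //; apply/lang_atomsP.
Qed.

Lemma lang_ifP B L K a w :
  lang_if B L K (a, w) <-> (B a /\ L (a, w)) \/ (~ B a /\ K (a, w)).
Proof.
rewrite -(atoms_fusionP B) -(atoms_fusionP (~` B)); exact: iff_refl.
Qed.

Lemma act_fusionP p L a w :
  lang_fusion (lang_act p) L (a, w) <->
  exists b v, w = (p, b) :: v /\ L (b, v).
Proof.
rewrite lang_fusionP; split=> [[u [v [-> [_ [b [_ ->]]] Lv]]]|[b [v [-> Lv]]]].
  by exists b, v.
by exists [:: (p, b)], v; split=> //; exists a, b.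
Qed.

(** This is $K^* M$. Leaving the exit [M] arbitrary lets the iteration absorb whatever is fused on
    its right. *)
Definition lang_iter K M : set (gs Sigma T) :=
  \bigcup_n lang_fusion (lang_pow K n) M.

Lemma lang_whileE B L : lang_while B L =
  lang_iter (lang_fusion (lang_atoms B) L) (lang_atoms (~` B)).
Proof. by []. Qed.

Lemma lang_iter_fusion K M N :
  lang_fusion (lang_iter K M) N = lang_iter K (lang_fusion M N).
Proof.
apply/seteqP; split=> -[a w].
  move=> /lang_fusionP[u [v [-> [n _ Ku] Nv]]]; exists n => //.
  by rewrite lang_fusionA; apply/lang_fusionP; exists u, v.
case=> n _; rewrite lang_fusionA => /lang_fusionP[u [v [-> Ku Nv]]].
by apply/lang_fusionP; exists u, v; split=> //; exists n.
Qed.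

(** [lang_pow] adds factors on the right, whereas unrolling a loop peels off the leftmost one. *)
Lemma lang_powSl K n : lang_pow K n.+1 = lang_fusion K (lang_pow K n).
Proof.
elim: n => [|n IHn]; first by rewrite /= fusion1l fusion1r.
by rewrite -[LHS]/(lang_fusion (lang_pow K n.+1) K) {1}IHn -lang_fusionA.
Qed.

Lemma lang_iter_base K M : M `<=` lang_iter K M.
Proof. by move=> x Mx; exists 0 => //; rewrite fusion1l. Qed.

Lemma lang_iter_step K M : lang_fusion K (lang_iter K M) `<=` lang_iter K M.
Proof.
move=> [a w] /lang_fusionP[u [v [-> Ku [n _ Kv]]]]; exists n.+1 => //.
by rewrite lang_powSl -lang_fusionA; apply/lang_fusionP; exists u, v.
Qed.

(** With [lang_iter_base] and [lang_iter_step], this makes [lang_iter K M] the least language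
    containing [M] and closed under fusion with [K] on the left. *)
Lemma lang_iter_min K M H :
  M `<=` H -> lang_fusion K H `<=` H -> lang_iter K M `<=` H.
Proof.
move=> MH KH x [n _]; elim: n x => [|n IHn] x.
  by rewrite /= fusion1l; exact: MH.
rewrite lang_powSl -lang_fusionA => Kx.
exact/KH/(lang_fusionS (@subset_refl _ K) IHn).
Qed.

(* Arden's rule.  Strings of [K] of length zero never help, hence uniqueness
   holds even though [K] may contain them. *)
Lemma arden K M H :
  M `<=` H -> lang_fusion K H `<=` H ->
  H `<=` M `|` lang_fusion (K `&` [set x | x.2 <> [::]]) H ->
  H = lang_iter K M.
Proof.
move=> MH KH HMK; apply/seteqP; split; last exact: lang_iter_min.
move=> [a w]; have [n] := ubnP (size w).
elim: n a w => // n IHn a w; rewrite ltnS => wn /HMK[Mw|].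
  exact: lang_iter_base.
move=> /lang_fusionP[u [v [wE [Ku /= u0] Hv]]].
apply/lang_iter_step/lang_fusionP; exists u, v; split=> //.
apply: IHn Hv; move: wn; rewrite wE size_cat; case: u u0 {wE Ku} => //= z u _.
by apply: leq_trans; rewrite addSn ltnS leq_addl.
Qed.

End Languages.

(** * Languages of pseudo-states *)

Section PseudoStates.
Variables Sigma T : Type.

(** The first atom is left free here; [glang] ties it to the atom at which the pseudo-state was
    consulted. *)
Definition glang_out (X : coalg Sigma T) (o : bool + Sigma * X) :
    set (gs Sigma T) :=
  match o with
  | inl true => lang_atoms setT
  | inl false => set0
  | inr (p, x) => lang_fusion (lang_act p) (lang x)
  end.

(* The language of a pseudo-state: a would-be state with successors [i]. *)
Definition glang (X : coalg Sigma T) (i : G Sigma T X) : set (gs Sigma T) :=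
  [set x | glang_out (i x.1) x].

Lemma lang_glang (X : coalg Sigma T) (x : X) : lang x = glang (delta x).
Proof.
apply/seteqP; split=> -[a w]; rewrite /glang /lang /=.
  case: w => [/= ->|[p b] w [t [-> tw]]] /=; first exact/lang_atomsP.
  by apply/act_fusionP; exists b, w.
case E: (delta x a) => [[]|[p t]] //=; first by move/lang_atomsP => [_ ->].
by move/act_fusionP => [b [v [-> tv]]] /=; exists t.
Qed.

(** A fusion starts with the first atom of its left factor, so [i a] alone selects the case. *)
Lemma glang_fusionP (X : coalg Sigma T) (i : G Sigma T X) K a w :
  lang_fusion (glang i) K (a, w) <->
  match i a with
  | inl true => K (a, w)
  | inl false => False
  | inr (p, x) => lang_fusion (lang_act p) (lang_fusion (lang x) K) (a, w)
  end.
Proof.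
have -> : lang_fusion (glang i) K (a, w) <->
    lang_fusion (glang_out (i a)) K (a, w).
  by split=> /lang_fusionP[u [v [-> iu Kv]]]; apply/lang_fusionP; exists u, v.
case: (i a) => [[]|[p x]] /=.
- by rewrite fusion1l.
- by split=> // /lang_fusionP[u [v [_ []]]].
- by rewrite lang_fusionA.
Qed.

(** * States and pseudo-states of a uniform continuation *)

Section UniformContinuation.
Variables (X Y : coalg Sigma T) (h : G Sigma T (X + Y)).

Definition cont : coalg Sigma T :=
  @unif_cont Sigma T (coprod X Y) (range inl) h.

(** Extends the continuation to pseudo-states of [X]: acceptance is replaced by [h], exactly as for
    the states of [X]. *)
Definition gcont (i : G Sigma T X) : G Sigma T cont := fun a =>
  match i a with
  | inl true => h a
  | inl false => inl false
  | inr (p, x) => inr (p, inl x)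
  end.

Definition ginr (i : G Sigma T Y) : G Sigma T cont := fun a =>
  match i a with
  | inl o => inl o
  | inr (p, y) => inr (p, inr y)
  end.

Lemma delta_cont_inl (x : X) : @delta _ _ cont (inl x) = gcont (delta x).
Proof.
apply/funext => a; rewrite /= /gcont.
case: (delta x a) => [[]|[p x']] //=.
by rewrite mem_set //; exists x.
Qed.

Lemma delta_cont_inr (y : Y) : @delta _ _ cont (inr y) = ginr (delta y).
Proof.
apply/funext => a; rewrite /= /ginr.
case: (delta y a) => [[]|[p y']] //=.
by rewrite memNset // => -[].
Qed.

(** States of [Y] lie outside [range inl], so they keep their acceptance and lead only to states of
    [Y]. *)
Lemma lang_cont_inr (y : Y) : @lang _ _ cont (inr y) = lang y.
Proof.
suff h' w a : @lang _ _ cont (inr y) (a, w) <-> lang y (a, w).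
  by apply/seteqP; split=> -[a w] /h'.
elim: w y a => [|[q c] w IHw] y a;
  rewrite !lang_glang delta_cont_inr /glang /= /ginr.
  case: (delta y a) => [o|[p y']] //.
  by rewrite /= !act_fusionP; split=> -[b [v []]].
case: (delta y a) => [o|[p y']] //.
rewrite /= !act_fusionP.
by split=> -[b [v [[-> <- <-] /IHw]]]; exists c, w.
Qed.

Lemma glang_ginr (i : G Sigma T Y) : glang (ginr i) = glang i.
Proof.
apply/funext => -[a w]; rewrite /glang /= /ginr.
by case: (i a) => [o|[q y]] //=; rewrite lang_cont_inr.
Qed.

(** Where [x] would accept at some atom, the run continues as [h] at that same atom, which is the
    one shared in the fusion. Since [h] may lead back into [X], its language is taken in [cont]
    itself. *)
Lemma lang_cont_inl (x : X) :
  @lang _ _ cont (inl x) = lang_fusion (lang x) (glang (X := cont) h).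
Proof.
suff h' w a : @lang _ _ cont (inl x) (a, w) <->
    lang_fusion (lang x) (glang (X := cont) h) (a, w).
  by apply/seteqP; split=> -[a w] /h'.
elim: w x a => [|[q c] w IHw] x a;
  rewrite !lang_glang delta_cont_inl glang_fusionP /glang /= /gcont;
  case: (delta x a) => [[]|[p x']] //=; rewrite !act_fusionP.
  by split=> -[b [v []]].
by split=> -[b [v [[-> <- <-] /IHw]]]; exists c, w.
Qed.

Lemma glang_gcont (i : G Sigma T X) :
  glang (gcont i) = lang_fusion (glang i) (glang (X := cont) h).
Proof.
apply/seteqP; split=> -[a w]; rewrite glang_fusionP /glang /= /gcont;
  by case: (i a) => [[]|[p x]] //=; rewrite lang_cont_inl.
Qed.

Lemma finite_cont :
  finite_set [set: X] -> finite_set [set: Y] -> finite_set [set: cont].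
Proof.
move=> finX finY; have -> : [set: cont] = range inl `|` range inr.
  by apply/seteqP; split=> // -[x|y] _; [left; exists x | right; exists y].
by rewrite finite_setU; split; exact: finite_image.
Qed.

End UniformContinuation.

(** * Thompson's construction *)

Definition discrete (S : Type) : coalg Sigma T :=
  Coalg (fun (_ : S) _ => inl true).

Lemma well_nested_discrete (S : Type) : well_nested (discrete S).
Proof. by constructor => x a; exists true. Qed.

Lemma lang_discrete (S : Type) (s : discrete S) : lang s = lang_atoms setT.
Proof. by rewrite lang_glang. Qed.

Definition realizable (L : set (gs Sigma T)) : Prop :=
  exists (X : coalg Sigma T) (i : G Sigma T X),
    [/\ well_nested X, finite_set [set: X] & L = glang i].

(** To make a pseudo-state into a state, a single state accepting at once is put in front and
    continued along the pseudo-state. *)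
Lemma realizable_lang L : realizable L <->
  exists (X : coalg Sigma T) (i : X),
    [/\ well_nested X, finite_set [set: X] & L = lang i].
Proof.
split=> -[X [i [wnX finX ->]]]; last first.
  by exists X, (delta i); rewrite -lang_glang.
pose h : G Sigma T (discrete unit + X) := fun a =>
  match i a with
  | inl o => inl o
  | inr (p, x) => inr (p, inr x)
  end.
exists (cont h), (inl tt); split.
- exact: wn_cont (well_nested_discrete _) wnX.
- by apply: finite_cont => //; exact: (@finite_finset unit).
- rewrite lang_cont_inl lang_discrete fusion1l.
  exact: esym (glang_ginr _ _).
Qed.

Lemma realizable_act p : realizable (lang_act p).
Proof.
exists (discrete unit), (fun=> inr (p, tt)); split=> //.
- exact: well_nested_discrete.
- exact: (@finite_finset unit).
- by apply/funext => x; rewrite /glang /= lang_discrete fusion1r.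
Qed.

Lemma realizable_atoms B : realizable (lang_atoms B).
Proof.
exists (discrete void), (fun a => inl `[< B a >]); split=> //.
- exact: well_nested_discrete.
- exact: (@finite_finset void).
apply/seteqP; split=> -[a w]; rewrite /glang /=.
  by move=> /lang_atomsP[Ba ->]; rewrite asboolT //; apply/lang_atomsP.
by case: asboolP => //= Ba /lang_atomsP[_ ->]; apply/lang_atomsP.
Qed.

Lemma realizable_fusion L K :
  realizable L -> realizable K -> realizable (lang_fusion L K).
Proof.
move=> [X [i [wnX finX ->]]] [Y [j [wnY finY ->]]].
(* Continuing along [j] makes every acceptance in [X] start the second language. *)
pose h : G Sigma T (X + Y) := fun a =>
  match j a with
  | inl o => inl o
  | inr (p, y) => inr (p, inr y)
  end.
exists (cont h), (gcont h i); split.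
- exact: wn_cont.
- exact: finite_cont.
- by rewrite glang_gcont -(glang_ginr h j).
Qed.

Lemma realizable_if B L K :
  realizable L -> realizable K -> realizable (lang_if B L K).
Proof.
move=> [X [i [wnX finX ->]]] [Y [j [wnY finY ->]]].
(* Replacing acceptance by acceptance changes no language, so this is the plain coproduct in the
   form [wn_cont] requires; the pseudo-state does the branching. *)
pose h : G Sigma T (X + Y) := fun=> inl true.
exists (cont h), (fun a => if `[< B a >] then gcont h i a else ginr h j a).
split; [exact: wn_cont | exact: finite_cont |].
have Li : glang (gcont h i) = glang i by rewrite glang_gcont fusion1r.
have Lj := glang_ginr h j.
apply/seteqP; split=> -[a w]; rewrite lang_ifP -Li -Lj /glang /=.
  by case=> -[Ba]; [rewrite asboolT | rewrite asboolF].
by case: asboolP => Ba ?; [left | right].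
Qed.

Lemma realizable_while B L : realizable L -> realizable (lang_while B L).
Proof.
move=> [X [i [wnX finX ->]]].
(* [h] is both the start of the loop and the continuation of its body. The empty summand only
   supplies the shape of [wn_cont]. *)
pose h : G Sigma T (X + discrete void) := fun a =>
  if `[< B a >] then
    match i a with
    (* A body accepting at once inside [B] would repeat the same test forever, so it contributes no
       string. *)
    | inl _ => inl false
    | inr (p, x) => inr (p, inl x)
    end
  else inl true.
exists (cont h), h; split.
- exact: wn_cont wnX (well_nested_discrete _).
- apply: finite_cont => //.
  exact: (@finite_finset void).
have hT a : B a -> h a = match i a with
                         | inl _ => inl false
                         | inr (p, x) => inr (p, inl x)
                         end by move=> Ba; rewrite /h asboolT.
have hF a : ~ B a -> h a = inl true by move=> nBa; rewrite /h asboolF.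
apply/esym/arden => -[a w].
- move=> /lang_atomsP[/= nBa ->]; rewrite /glang /= hF //.
  exact/lang_atomsP.
- rewrite -lang_fusionA atoms_fusionP glang_fusionP => -[Ba].
  (* If the body accepts at once, what remains is already a string of [h]. *)
  case E: (i a) => [[]|[p x]] //.
  by rewrite -lang_cont_inl /glang /= hT // E.
rewrite {1}/glang /=; have [Ba|nBa] := pselect (B a); last first.
  rewrite hF // => /lang_atomsP[_ ->].
  by left; apply/lang_atomsP.
rewrite hT //; case E: (i a) => [//|[p x]] /=.
rewrite lang_cont_inl => /act_fusionP[b [v [->]]].
move=> /lang_fusionP[u [z [-> xu hz]]]; right.
(* The leading action makes this round nonempty, as [arden] demands. *)
apply/lang_fusionP; exists ((p, b) :: u), z; split=> //; split=> //.
rewrite atoms_fusionP; split=> //; rewrite /glang /= E /=.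
by apply/act_fusionP; exists b, u.
Qed.

Lemma realizable_sem (e : gexp Sigma T) : realizable (sem e).
Proof.
elim: e => [p|b|e IHe f IHf|b e IHe f IHf|b e IHe] /=.
- exact: realizable_act.
- exact: realizable_atoms.
- exact: realizable_fusion.
- exact: realizable_if.
- exact: realizable_while.
Qed.

End PseudoStates.

(** * Languages denoted by expressions *)

Section Definable.
Variables (Sigma : Type) (T : finType).
Implicit Types (L K : set (gs Sigma T)) (B : set (At T)).

Definition definable L : Prop := exists e : gexp Sigma T, L = sem e.

(** The test is the disjunction of the representatives of the atoms in [B], a finite one by
    [finite_At]. *)
Lemma bsem_surj B : exists b, B = bsem b.
Proof.
have [s sT] := finite_At T.
exists (foldr (fun a b => if `[< B a >] then BOr (at_repr a) b else b) BZero s).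
suff bsemE : forall a, at_le a
    (foldr (fun a b => if `[< B a >] then BOr (at_repr a) b else b) BZero s) <->
    a \in s /\ B a.
  apply/seteqP; split=> a; first by move=> Ba; apply/bsemE.
  by move=> /bsemE[].
elim: s {sT} => [|c s IHs] a /=; first by split=> [/at_le_zero|[]].
case: asboolP => Bc; rewrite ?at_le_or ?at_le_repr IHs in_cons.
  split=> [[->|[as_ Ba]]|[/orP[/eqP->|as_] Ba]]; rewrite ?eqxx ?as_ ?orbT //.
    by left.
  by right.
split=> [[as_ Ba]|[/orP[/eqP ac|as_] Ba]]; rewrite ?as_ ?orbT //.
by case: Bc; rewrite -ac.
Qed.

Lemma definable_act p : definable (lang_act p).
Proof. by exists (EAct T p). Qed.

Lemma definable_atoms B : definable (lang_atoms B).
Proof. by have [b ->] := bsem_surj B; exists (ETest Sigma b). Qed.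

Lemma definable_fusion L K :
  definable L -> definable K -> definable (lang_fusion L K).
Proof. by move=> [e ->] [f ->]; exists (ESeq e f). Qed.

Lemma definable_if B L K :
  definable L -> definable K -> definable (lang_if B L K).
Proof.
by have [b ->] := bsem_surj B; move=> [e ->] [f ->]; exists (EIf b e f).
Qed.

Lemma definable_while B L : definable L -> definable (lang_while B L).
Proof. by have [b ->] := bsem_surj B; move=> [e ->]; exists (EWhile b e). Qed.

Lemma definable_set0 : definable set0.
Proof.
have -> : set0 = lang_atoms set0 :> set (gs Sigma T).
  by apply/seteqP; split=> // -[a w] /lang_atomsP[].
exact: definable_atoms.
Qed.

(** A cascade of guarded choices runs through the finitely many atoms, each guard singling out one
    of them. *)
Lemma definable_choice (F : At T -> set (gs Sigma T)) :
  (forall a, definable (F a)) -> definable [set x | F x.1 x].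
Proof.
move=> defF; have [s sT] := finite_At T.
(* Restricting to first atoms in [s] gives a statement that can be proved by induction on [s]. *)
have -> : [set x | F x.1 x] = [set x | x.1 \in s /\ F x.1 x].
  by apply/seteqP; split=> x //= [].
elim: s {sT} => [|c s IHs].
  have -> : [set x | x.1 \in [::] /\ F x.1 x] = set0.
    by apply/seteqP; split=> x // [].
  exact: definable_set0.
have -> : [set x | x.1 \in c :: s /\ F x.1 x] =
    lang_if [set c] (F c) [set x | x.1 \in s /\ F x.1 x].
  apply/seteqP; split=> -[a w]; rewrite lang_ifP /= in_cons; last first.
    by case=> -[]; [move=> ->; rewrite eqxx | move=> _ [-> Fa]; rewrite orbT].
  have [->|/eqP ac] := eqVneq a c; first by case=> _; left.
  by move=> Fa; right.
exact: definable_if.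
Qed.

Lemma definable_glang (X : coalg Sigma T) (i : G Sigma T X) :
  (forall a p x, i a = inr (p, x) -> definable (lang x)) -> definable (glang i).
Proof.
move=> defX; apply: (@definable_choice (fun a => glang_out (i a))) => a.
case E: (i a) => [[]|[p x]] /=.
- exact: definable_atoms.
- exact: definable_set0.
- by apply: definable_fusion; [exact: definable_act | exact: defX E].
Qed.

(** * Expressions for a uniform continuation *)

Section UniformContinuation.
Variables (X Y : coalg Sigma T) (h : G Sigma T (X + Y)).
Hypothesis defX : forall x : X, definable (lang x).
Hypothesis defY : forall y : Y, definable (lang y).

Let reenters : set (At T) := [set a | exists p x, h a = inr (p, inl x)].

(* What [h] does until it re-enters [X] and [X] terminates, or until the end if
   [X] is not re-entered. *)
Let round (a : At T) : set (gs Sigma T) :=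
  match h a with
  | inl true => lang_atoms setT
  | inl false => set0
  | inr (p, inl x) => lang_fusion (lang_act p) (lang x)
  | inr (p, inr y) => lang_fusion (lang_act p) (lang y)
  end.

Let once : set (gs Sigma T) := [set x | round x.1 x].

Let definable_once : definable once.
Proof.
apply: definable_choice => a; rewrite /round.
case: (h a) => [[]|[p [x|y]]].
- exact: definable_atoms.
- exact: definable_set0.
- exact: definable_fusion (definable_act p) (defX x).
- exact: definable_fusion (definable_act p) (defY y).
Qed.

(** On [reenters], [once] is a run through [X] after which [h] starts again; elsewhere it is already
    all that [h] accepts. It is thus both the loop body and the final part. *)
Lemma glang_cont_loop :
  glang (X := cont h) h = lang_fusion (lang_while reenters once) once.
Proof.
(* The final [once] moves into the exit of the iteration, where the loop test restricts it to atoms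
   outside [reenters]. *)
rewrite lang_whileE lang_iter_fusion.
apply: arden => -[a w].
- rewrite atoms_fusionP => -[/= nre]; rewrite /once /glang /= /round.
  case E: (h a) => [o|[p [x|y]]] //; last by rewrite /= lang_cont_inr.
  by case: nre; exists p, x.
- rewrite -lang_fusionA atoms_fusionP => -[[p [x hE]]].
  move=> /lang_fusionP[u [v [-> ]]]; rewrite /once /= /round hE.
  move=> /act_fusionP[b [u' [-> xu']]] hv; rewrite /glang /= hE /=.
  apply/act_fusionP; exists b, (u' ++ v); split=> //.
  by rewrite lang_cont_inl; apply/lang_fusionP; exists u', v.
rewrite {1}/glang /=; case E: (h a) => [o|[p [x|y]]] /=.
- move=> ho; left; apply/atoms_fusionP; rewrite /once /= /round E.
  by split=> // -[p [x]]; rewrite E.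
- rewrite lang_cont_inl => /act_fusionP[b [v [->]]].
  move=> /lang_fusionP[u [z [-> xu hz]]]; right.
  apply/lang_fusionP; exists ((p, b) :: u), z; split=> //; split=> //.
  rewrite atoms_fusionP; split; first by exists p, x.
  by rewrite /once /= /round E; apply/act_fusionP; exists b, u.
- rewrite lang_cont_inr => yw; left; apply/atoms_fusionP.
  rewrite /once /= /round E; split=> // -[q [x]].
  by rewrite E.
Qed.

Lemma definable_cont (z : cont h) : definable (lang z).
Proof.
case: z => [x|y]; last by rewrite lang_cont_inr.
rewrite lang_cont_inl glang_cont_loop; apply: definable_fusion => //.
by apply: definable_fusion => //; exact: definable_while.
Qed.

End UniformContinuation.

Lemma definable_lang (X : coalg Sigma T) (x : X) :
  well_nested X -> definable (lang x).
Proof.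
move=> wnX; elim: wnX x => {X} [X discX|X Y h _ IHX _ IHY] x.
  rewrite lang_glang; apply: definable_glang => a p y E.
  (* Without transitions there is no successor whose language would have to be definable. *)
  by have [o] := discX x a; rewrite E.
exact: definable_cont.
Qed.

End Definable.

Theorem corollary4p10 (Sigma : Type) (T : finType)
    (Sigma_nonempty : inhabited Sigma) (T_nonempty : (0 < #|T|)%N)
    (L : set (gs Sigma T)) :
  (exists e : gexp Sigma T, L = sem e) <->
  (exists (X : coalg Sigma T) (i : X),
     [/\ well_nested X, finite_set [set: X] & L = lang i]).
Proof.
rewrite -realizable_lang; split=> [[e ->]|]; first exact: realizable_sem.
by move=> /realizable_lang[X [i [wnX _ ->]]]; exact: definable_lang.
Qed.
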